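(* Let $(N,g)$ be a Riemannian manifold and let $G$ be the neutral metric on $TN$ given by $G(\bar X,\bar Y)=g(\Pi\bar X,K\bar Y)+g(K\bar X,\Pi\bar Y)$. A curve $\gamma(t)=(x(t),V(t))$ in $TN$ is a geodesic with respect to $G$ if and only if the curve $x$ is a geodesic of $(N,g)$ and $V$ is a Jacobi field along $x$.
   Context: Let $D$ be the Levi-Civita connection of $g$ and $\pi:TN\to N$ the canonical projection. For $\bar X\in T_{(p,V)}TN$ write $\Pi\bar X=d\pi(\bar X)\in T_pN$. The connection map $K:TTN\to TN$ is defined as follows: if $\bar X=a'(0)$ for a curve $a(t)=(p(t),V(t))$ in $TN$, then $K\bar X=(D_{p'}V)(0)\in T_pN$, the covariant derivative of $V(t)$ along $p(t)$ at $t=0$ (for a vertical vector, i.e. $p'(0)=0$, this is the ordinary derivative $V'(0)$ in the fibre). The map $\bar X\mapsto(\Pi\bar X,K\bar X)$ is an isomorphism $T_{(p,V)}TN\cong T_pN\oplus T_pN$, and $G$ is a pseudo-Riemannian metric of neutral signature. Geodesics are curves (affinely parametrized) with vanishing covariant acceleration. The curvature convention is $R(X,Y)Z=D_XD_YZ-D_YD_XZ-D_{[X,Y]}Z$, and $V$ is a Jacobi field along a geodesic $x$ if $D_{x'}D_{x'}V+R(V,x')x'=0$. *)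

(* Defs.v *)
From HB Require Import structures.
From mathcomp Require Import all_boot all_order all_algebra.
From mathcomp Require Import all_classical all_reals all_analysis.
From mathcomp Require Import ring.

Set Implicit Arguments.
Unset Strict Implicit.
Unset Printing Implicit Defensive.

Import Order.TTheory GRing.Theory Num.Theory.
Import numFieldNormedType.Exports.

Local Open Scope ring_scope.
Local Open Scope classical_set_scope.

(* C^oo on an open set: all iterated directional derivatives are Frechet
   differentiable at every point. *)
Definition smooth_on (R : realType) (V W : normedModType R) (U : set V)
    (f : V -> W) : Prop :=
  forall (vs : seq V) (x : V), U x ->
    differentiable (foldr (fun v (h : V -> W) => 'D_v h) f vs) x.

Definition is_bilinear (R : realType) (V : lmodType R) (W : zmodType)
    (s : R -> W -> W) (f : V -> V -> W) : Prop :=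
  (forall v, linear_for s (f ^~ v)) /\ (forall u, linear_for s (f u)).

(** ** Manifolds *)

(* [chart a] is only meaningful on [dom a]. *)
Record atlas (R : realType) (n : nat) (M : Type) := Atlas {
  idx : Type ;
  dom : idx -> set M ;
  chart : idx -> M -> 'rV[R]_n }.

Section Manifold.
Variables (R : realType) (n : nat) (M : Type) (A : atlas R n M).

Definition chart_image (a : idx A) : set 'rV[R]_n := chart a @` dom a.

(* chart b \o (chart a)^-1 on chart a @` (dom a `&` dom b), and 0 elsewhere *)
Definition transition (a b : idx A) (z : 'rV[R]_n) : 'rV[R]_n :=
  xget 0 [set w | exists p,
    [/\ dom a p, dom b p, chart a p = z & chart b p = w]].

(* A tangent vector at p is given by its components in the charts around p,
   related by the differentials of the transition maps; the components in the
   other charts are normalised to 0 so that equal vectors are Leibniz equal. *)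
Record tangent (p : M) := Tangent {
  comp :> idx A -> 'rV[R]_n ;
  comp_compat : forall a b, dom a p -> dom b p ->
    comp b = 'd (transition a b) (chart a p) (comp a) ;
  comp_out : forall a, ~ dom a p -> comp a = 0 }.

Definition tangent_bundle : Type := {p : M & tangent p}.

(* The charts (p, V) |-> (x(p), components of V) of the tangent bundle; its
   transition maps and its topology are those determined by these charts. *)
Definition tangent_atlas : atlas R (n + n) tangent_bundle :=
  @Atlas R (n + n) tangent_bundle (idx A)
    (fun a q => dom a (projT1 q))
    (fun a q => row_mx (chart a (projT1 q)) (comp (projT2 q) a)).

(* A smooth curve on the open set J of parameters. The values outside J are
   irrelevant. The first conjunct expresses continuity. *)
Definition smooth_curve (J : set R) (c : R -> M) : Prop :=
  forall (a : idx A) (t : R), J t -> dom a (c t) ->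
    (\forall s \near t, dom a (c s)) /\
    (forall k : nat, derivable (derive1n k (fun s => chart a (c s))) t 1).

(* A field of bilinear forms on the tangent spaces, through its expressions in
   the coordinates of the charts: [g a z] is the form at the point of
   coordinates z, on tangent vectors given by their components. *)
Definition form_field : Type :=
  idx A -> 'rV[R]_n -> 'rV[R]_n -> 'rV[R]_n -> R.

End Manifold.

(* The topology of N is the manifold topology: the charts are homeomorphisms
   from open sets onto open sets. *)
Definition smooth_manifold (R : realType) (n : nat) (N : topologicalType)
    (A : atlas R n N) : Prop :=
  [/\ hausdorff_space N /\ @second_countable N,
      (forall p : N, exists a : idx A, dom a p),
      (forall a : idx A, open (dom a) /\ set_inj (dom a) (chart a)),
      (forall (a : idx A) (W : set N), W `<=` dom a ->
         (open W <-> open (chart a @` W))) &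
      (forall a b : idx A,
         smooth_on (chart a @` (dom a `&` dom b)) (transition a b))].

Definition riemannian_metric (R : realType) (n : nat) (M : Type)
    (A : atlas R n M) (g : form_field A) : Prop :=
  [/\ (forall a z, chart_image a z -> is_bilinear *%R (g a z)),
      (forall a z u v, chart_image a z -> g a z u v = g a z v u),
      (forall a z u, chart_image a z -> u != 0 -> 0 < g a z u u),
      (forall a u v, smooth_on (chart_image a) (fun z => g a z u v)) &
      (forall a b p u v, dom a p -> dom b p ->
         let dtau := 'd (transition a b) (chart a p) in
         g a (chart a p) u v = g b (chart b p) (dtau u) (dtau v))].

(** ** Connections in a coordinate domain *)

Section Connection.
Variables (R : realType) (n : nat).
Local Notation vec := 'rV[R]_n.

(* [Gam z u v] is the covariant derivative at z, in direction u, of the vector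
   field with constant components v (the Christoffel symbols). *)
Implicit Types (Gam : vec -> vec -> vec -> vec) (X Y Z : vec -> vec).

Definition nabla Gam X Y : vec -> vec :=
  fun z => 'D_(X z) Y z + Gam z (X z) (Y z).

Definition bracket X Y : vec -> vec :=
  fun z => 'D_(X z) Y z - 'D_(Y z) X z.

Definition curvature_field Gam X Y Z : vec -> vec :=
  fun z => nabla Gam X (nabla Gam Y Z) z - nabla Gam Y (nabla Gam X Z) z
    - nabla Gam (bracket X Y) Z z.

(* The curvature tensor at z, on the extensions with constant components. *)
Definition curvature Gam (z u v w : vec) : vec :=
  curvature_field Gam (cst u) (cst v) (cst w) z.

(* The covariant derivative of V along the curve x. *)
Definition covD Gam (x V : R -> vec) : R -> vec :=
  fun t => derive1 V t + Gam (x t) (derive1 x t) (V t).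

(* Gam is torsion-free and compatible with h on U *)
Definition is_levi_civita (U : set vec) (h : vec -> vec -> vec -> R) Gam :=
  forall z, U z ->
  [/\ is_bilinear *:%R (Gam z),
      (forall X Y, differentiable X z -> differentiable Y z ->
         nabla Gam X Y z - nabla Gam Y X z = bracket X Y z) &
      (forall X Y Z, differentiable X z -> differentiable Y z ->
         differentiable Z z ->
         'D_(X z) (fun y => h y (Y y) (Z y)) z
         = h z (nabla Gam X Y z) (Z z) + h z (Y z) (nabla Gam X Z z))].

End Connection.

(* The torsion-free metric connection of g in the chart a. It exists and is
   unique on the image of the chart ([levi_civitaP], [levi_civita_exists],
   [levi_civita_unique]); its values elsewhere are irrelevant. *)
Definition levi_civita (R : realType) (n : nat) (M : Type) (A : atlas R n M)
    (g : form_field A) (a : idx A) : 'rV[R]_n -> 'rV[R]_n -> 'rV[R]_n -> 'rV[R]_n :=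
  xget (fun _ _ _ => 0) [set Gam | is_levi_civita (chart_image a) (g a) Gam].

(* Vanishing covariant acceleration, for a smooth curve x. *)
Definition geodesic (R : realType) (n : nat) (M : Type) (A : atlas R n M)
    (g : form_field A) (J : set R) (x : R -> M) : Prop :=
  forall (a : idx A) (t : R), J t -> dom a (x t) ->
    let xa := fun s => chart a (x s) in
    covD (levi_civita g a) xa (derive1 xa) t = 0.

Definition jacobi_field (R : realType) (n : nat) (M : Type) (A : atlas R n M)
    (g : form_field A) (J : set R) (x : R -> M)
    (V : forall t, tangent A (x t)) : Prop :=
  forall (a : idx A) (t : R), J t -> dom a (x t) ->
    let xa := fun s => chart a (x s) in
    let Va := fun s => V s a in
    let D := covD (levi_civita g a) xa in
    D (D Va) t
      + curvature (levi_civita g a) (xa t) (Va t) (derive1 xa t) (derive1 xa t) = 0.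

(** ** The neutral metric of the tangent bundle *)

Section Neutral.
Variables (R : realType) (n : nat).

(* The differential of the projection (x, v) |-> x. *)
Definition dproj (X : 'rV[R]_(n + n)) : 'rV[R]_n := lsubmx X.

(* The connection map at the point (x, v) = zv: see [connection_mapE]. *)
Definition connection_map (Gam : 'rV[R]_n -> 'rV[R]_n -> 'rV[R]_n -> 'rV[R]_n)
    (zv X : 'rV[R]_(n + n)) : 'rV[R]_n :=
  rsubmx X + Gam (lsubmx zv) (lsubmx X) (rsubmx zv).

Definition neutral_metric (M : Type) (A : atlas R n M) (g : form_field A) :
    form_field (tangent_atlas A) :=
  fun a zv X Y =>
    let K := connection_map (levi_civita g a) zv in
    g a (lsubmx zv) (dproj X) (K Y) + g a (lsubmx zv) (K X) (dproj Y).

End Neutral.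

(** ** Well-definedness *)

Section LeviCivita.
Variables (R : realType) (n : nat) (U : set 'rV[R]_n).
Variable h : 'rV[R]_n -> 'rV[R]_n -> 'rV[R]_n -> R.
Hypothesis hbil : forall z, U z -> is_bilinear *%R (h z).
Hypothesis hsym : forall z u v, U z -> h z u v = h z v u.
Hypothesis hnondeg : forall z u, U z -> (forall v, h z u v = 0) -> u = 0.

Let hD z u v w : U z -> h z (u + v) w = h z u w + h z v w.
Proof. by move=> /hbil[/(_ w 1 u v) + _]; rewrite /= scale1r mul1r. Qed.
Let hZ z (k : R) u w : U z -> h z (k *: u) w = k * h z u w.
Proof.
move=> Uz; have h0 : h z 0 w = 0.
  by apply: (addrI (h z 0 w)); rewrite -hD// !addr0.
by have [/(_ w k u 0) + _] := hbil Uz; rewrite /= !addr0 h0 addr0.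
Qed.
Let hDr z u v w : U z -> h z w (u + v) = h z w u + h z w v.
Proof. by move=> Uz; rewrite !(hsym w) ?hD. Qed.
Let hZr z (k : R) u w : U z -> h z w (k *: u) = k * h z w u.
Proof. by move=> Uz; rewrite !(hsym w) ?hZ. Qed.
Let h0l z w : U z -> h z 0 w = 0.
Proof. by move=> Uz; rewrite -(scale0r 0) hZ// mul0r. Qed.
Let hsum z w (F : 'I_n -> 'rV[R]_n) : U z ->
  h z (\sum_i F i) w = \sum_i h z (F i) w.
Proof.
by move=> Uz; apply: (big_morph (fun u => h z u w)) => [u v|]; rewrite ?hD ?h0l.
Qed.
Let hE z u w : U z -> h z u w = \sum_i u 0 i * h z (delta_mx 0 i) w.
Proof.
by move=> Uz; rewrite {1}[u]row_sum_delta hsum//; apply: eq_bigr => i _; rewrite hZ.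
Qed.
Let hE2 z u w : U z ->
  h z u w = \sum_i \sum_j u 0 i * (w 0 j * h z (delta_mx 0 i) (delta_mx 0 j)).
Proof.
move=> Uz; rewrite hE//; apply: eq_bigr => i _.
by rewrite hsym// hE// mulr_sumr; apply: eq_bigr => j _; rewrite (hsym (delta_mx 0 j)).
Qed.

Let nabla_cst Gam u v z : nabla Gam (cst u) (cst v) z = Gam z u v :> 'rV[R]_n.
Proof. by rewrite /nabla derive_cst add0r. Qed.

Let lc_sym Gam z u v : is_levi_civita U h Gam -> U z -> Gam z u v = Gam z v u.
Proof.
move=> lc /lc[_ /(_ (cst u) (cst v)) + _]; rewrite !nabla_cst /bracket !derive_cst subrr.
by move=> /(_ (differentiable_cst _ _) (differentiable_cst _ _)) /subr0_eq.
Qed.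

Let lc_metric Gam z u v w : is_levi_civita U h Gam -> U z ->
  'D_u (fun y => h y v w) z = h z (Gam z u v) w + h z v (Gam z u w).
Proof.
move=> lc /lc[_ _ /(_ (cst u) (cst v) (cst w))]; rewrite !nabla_cst.
by apply; exact: differentiable_cst.
Qed.

Let koszul u v w z := 2^-1 *
  ('D_u (fun y => h y v w) z + 'D_v (fun y => h y u w) z - 'D_w (fun y => h y u v) z).

Let lc_koszul Gam z u v w : is_levi_civita U h Gam -> U z ->
  h z (Gam z u v) w = koszul u v w z.
Proof.
move=> lc Uz; rewrite /koszul !(lc_metric _ _ _ lc Uz).
rewrite (lc_sym w u lc Uz) (lc_sym w v lc Uz) (lc_sym v u lc Uz).
rewrite (hsym (Gam z u w) v)//.
by field.
Qed.

Lemma levi_civita_unique Gam Gam' :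
  is_levi_civita U h Gam -> is_levi_civita U h Gam' ->
  forall z, U z -> Gam z = Gam' z.
Proof.
move=> lc lc' z Uz; apply/funext => u; apply/funext => v.
apply/subr0_eq; apply: (hnondeg Uz) => w.
by rewrite hD// -scaleN1r hZ// !lc_koszul// mulN1r subrr.
Qed.

Hypothesis Uo : open U.
Hypothesis hdiff : forall z u v, U z -> differentiable (fun y => h y u v) z.

Let e (i : 'I_n) : 'rV[R]_n := delta_mx 0 i.
Let gram z := \matrix_(i, j) h z (e i) (e j).
Let Gamma z u v : 'rV[R]_n := (\row_l koszul u v (e l) z) *m invmx (gram z).

Let gramE z u j : U z -> h z u (e j) = (u *m gram z) 0 j.
Proof.
by move=> Uz; rewrite hE// [RHS]mxE; apply: eq_bigr => k _; rewrite [in RHS]mxE.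
Qed.

Let gram_unit z : U z -> gram z \in unitmx.
Proof.
move=> Uz; rewrite -row_free_unit -kermx_eq0; apply/eqP/row_matrixP => i.
rewrite row0; set u := row i _.
have ug : u *m gram z = 0 by apply/sub_kermxP; exact: row_sub.
move: u ug => {i}u ug.
apply: (hnondeg Uz) => w; rewrite hsym// hE//; apply: big1 => j _.
by rewrite hsym// [h z _ _]gramE// ug mxE mulr0.
Qed.

Let derh_near z u (f g : 'rV[R]_n -> R) : U z -> (forall y, U y -> f y = g y) ->
  'D_u f z = 'D_u g z.
Proof.
move=> Uz fg; apply: near_eq_derive; near=> y; apply: fg.
by near: y; exact: open_nbhs_nbhs.
Unshelve. all: by end_near. Qed.

Let dD1 z k u u' v w : U z -> 'D_(k *: u + u') (fun y => h y v w) z =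
  k * 'D_u (fun y => h y v w) z + 'D_u' (fun y => h y v w) z.
Proof. by move=> Uz; rewrite !deriveE ?linearP//; exact: hdiff. Qed.

Let dD2 z k u v v' w : U z -> 'D_u (fun y => h y (k *: v + v') w) z =
  k * 'D_u (fun y => h y v w) z + 'D_u (fun y => h y v' w) z.
Proof.
move=> Uz.
rewrite (derh_near u (g := (k *: (fun y => h y v w)) + (fun y => h y v' w)))//; last first.
  by move=> y Uy; rewrite hD// hZ.
have dv : derivable (fun y => h y v w) z u by exact/diff_derivable/hdiff.
have dv' : derivable (fun y => h y v' w) z u by exact/diff_derivable/hdiff.
by rewrite (deriveD (derivableZ (k := k) dv) dv') (deriveZ k dv).
Qed.

Let dC z u v w : U z -> 'D_u (fun y => h y v w) z = 'D_u (fun y => h y w v) z.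
Proof. by move=> Uz; apply: derh_near => // y Uy; exact: hsym. Qed.

Let dD3 z k u v v' w : U z -> 'D_u (fun y => h y w (k *: v + v')) z =
  k * 'D_u (fun y => h y w v) z + 'D_u (fun y => h y w v') z.
Proof. by move=> Uz; rewrite !(dC _ w)// dD2. Qed.

Let koszul_lin1 z k u u' v w : U z ->
  koszul (k *: u + u') v w z = k * koszul u v w z + koszul u' v w z.
Proof. by move=> Uz; rewrite /koszul dD1// !dD2//; ring. Qed.

Let koszul_lin3 z k u v w w' : U z ->
  koszul u v (k *: w + w') z = k * koszul u v w z + koszul u v w' z.
Proof. by move=> Uz; rewrite /koszul dD1// !dD3//; ring. Qed.

Let koszulC z u v w : U z -> koszul u v w z = koszul v u w z.
Proof. by move=> Uz; rewrite /koszul (dC w u v)//; ring. Qed.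

Let GammaC z u v : U z -> Gamma z u v = Gamma z v u.
Proof.
by move=> Uz; congr (_ *m _); apply/rowP => l; rewrite !mxE koszulC.
Qed.

Let Gamma_lin z v : U z -> linear_for *:%R ((Gamma z)^~ v).
Proof.
move=> Uz k u u' /=; rewrite /Gamma scalemxAl -mulmxDl; congr (_ *m _).
by apply/rowP => l; rewrite !mxE koszul_lin1.
Qed.

Let GammaE z u v w : U z -> h z (Gamma z u v) w = koszul u v w z.
Proof.
move=> Uz; rewrite hsym// hE//.
have -> : koszul u v w z = \sum_i w 0 i * koszul u v (e i) z.
  have k0 : koszul u v 0 z = 0.
    by have := koszul_lin3 (-1) u v 0 0 Uz; rewrite scaler0 addr0 mulN1r addNr.
  rewrite {1}[w]row_sum_delta.
  rewrite (@big_morph _ _ (fun w => koszul u v w z) 0 +%R 0 +%R)//.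
    apply: eq_bigr => i _; have := koszul_lin3 (w 0 i) u v (e i) 0 Uz.
    by rewrite k0 !addr0.
  by move=> a b; have := koszul_lin3 1 u v a b Uz; rewrite scale1r mul1r.
apply: eq_bigr => i _; congr (_ * _).
rewrite hsym// [h z _ _]gramE//.
by rewrite /Gamma mulmxKV ?mxE// gram_unit.
Qed.

Let product_rule (Y Z : 'rV[R]_n -> 'rV[R]_n) z u : U z ->
  differentiable Y z -> differentiable Z z ->
  'D_u (fun y => h y (Y y) (Z y)) z =
    'D_u (fun y => h y (Y z) (Z z)) z + h z ('D_u Y z) (Z z) + h z (Y z) ('D_u Z z).
Proof.
move=> Uz dY dZ.
have dYu : derivable Y z u by exact: diff_derivable.
have dZu : derivable Z z u by exact: diff_derivable.
have dYi i : derivable (fun y => Y y 0 i) z u by have /derivable_mxP := dYu; exact.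
have dZi i : derivable (fun y => Z y 0 i) z u by have /derivable_mxP := dZu; exact.
have YE i : ('D_u Y z) 0 i = 'D_u (fun y => Y y 0 i) z by rewrite (derive_mx dYu) mxE.
have ZE i : ('D_u Z z) 0 i = 'D_u (fun y => Z y 0 i) z by rewrite (derive_mx dZu) mxE.
have dh i j : derivable (fun y => h y (e i) (e j)) z u by exact/diff_derivable/hdiff.
rewrite (derh_near u (f := fun y => h y (Y y) (Z y)) (g := \sum_i \sum_j
  ((fun y => Y y 0 i) * ((fun y => Z y 0 j) * (fun y => h y (e i) (e j))))))//; last first.
  move=> y Uy; rewrite hE2// fct_sumE; apply: eq_bigr => i _.
  by rewrite fct_sumE; apply: eq_bigr.
rewrite (derh_near u (f := fun y => h y (Y z) (Z z)) (g := \sum_i \sum_j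
  (cst (Y z 0 i) * (cst (Z z 0 j) * (fun y => h y (e i) (e j))))))//; last first.
  move=> y Uy; rewrite hE2// fct_sumE; apply: eq_bigr => i _.
  by rewrite fct_sumE; apply: eq_bigr.
rewrite !hE2// !derive_sum; last 2 first.
- by move=> i; apply: derivable_sum => j; do 2 apply: derivableM => //.
- by move=> i; apply: derivable_sum => j; do 2 apply: derivableM => //.
rewrite -!big_split/=; apply: eq_bigr => i _.
rewrite !derive_sum; last 2 first.
- by move=> j; do 2 apply: derivableM => //.
- by move=> j; do 2 apply: derivableM => //.
rewrite -!big_split/=; apply: eq_bigr => j _.
rewrite !deriveM//; try by [apply: derivableM].
rewrite YE ZE !derive_cst.
have scE (a b : R) : a *: b = a * b by [].
have fM (f f' : 'rV[R]_n -> R) : (f * f') z = f z * f' z by [].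
rewrite !fM !scE /cst /=.
ring.
Qed.

Lemma levi_civita_exists : exists Gam, is_levi_civita U h Gam.
Proof.
exists Gamma => z Uz; split.
- split=> [v|u]; first exact: Gamma_lin.
  by move=> k v v'; rewrite ![Gamma z u _]GammaC//; exact: Gamma_lin.
- move=> X Y dX dY; rewrite /nabla /bracket (GammaC (X z))// opprD addrACA subrr.
  by rewrite addr0.
- move=> X Y Z dX dY dZ; rewrite product_rule// /nabla hD// hDr//.
  rewrite (hsym (Y z) (Gamma _ _ _))// !GammaE// /koszul (dC (X z) (Z z))//.
  rewrite (dC (Y z) (X z))// (dC (Z z) (X z))//.

  by field.
Qed.
End LeviCivita.

Lemma levi_civitaP (R : realType) (n : nat) (N : topologicalType)
    (A : atlas R n N) (g : form_field A) (a : idx A) :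
  smooth_manifold A -> riemannian_metric g ->
  is_levi_civita (chart_image a) (g a) (levi_civita g a).
Proof.
move=> [_ _ domP homeo _] [gbil gsym gpos gsmooth _].
apply: (xgetPex (fun _ _ _ => 0) (P := [set Gam | is_levi_civita _ _ Gam])).
apply: levi_civita_exists.
- exact: gbil.
- by move=> z u v; exact: gsym.
- move=> z u Uz gu0; apply/eqP; apply: contraT => u0.
  by have := gpos a z u Uz u0; rewrite gu0 ltxx.
- by apply/homeo => //; have [] := domP a.
- by move=> z u v Uz; exact: (gsmooth a u v [::]).
Qed.

#[local] Lemma diff_chain (R : realType) (n : nat) (f f' f'' : 'rV[R]_n -> 'rV[R]_n)
    (z w v : 'rV[R]_n) :
  differentiable f z -> differentiable f' w -> differentiable f'' z ->
  f z = w -> (\forall y \near z, f'' y = f' (f y)) ->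
  'd f'' z v = 'd f' w ('d f z v).
Proof.
move=> df + df'' fz; rewrite -fz => df' near_eq.
have dff' := differentiable_comp df df'.
have dE := diff_comp df df'.
apply: (etrans (esym (deriveE v df''))).
apply: (etrans _ (congr1 (fun F => F v) dE)).
apply: (etrans _ (deriveE v dff')).
exact: near_eq_derive.
Qed.

#[local] Lemma diff_near_id (R : realType) (n : nat) (f : 'rV[R]_n -> 'rV[R]_n)
    (z v : 'rV[R]_n) :
  differentiable f z -> (\forall y \near z, f y = y) -> 'd f z v = v.
Proof.
move=> df near_id; apply: (etrans (esym (deriveE v df))).
by rewrite -[RHS](derive_id z v); exact: near_eq_derive.
Qed.

Section Tangent.
Variables (R : realType) (n : nat) (N : topologicalType) (A : atlas R n N).
Hypothesis Am : smooth_manifold A.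

Lemma transitionE (a b : idx A) (p : N) : dom a p -> dom b p ->
  transition a b (chart a p) = chart b p.
Proof.
move=> ap bp; apply: xget_unique; first by exists p.
move=> _ [q [aq bq aqp <-]]; congr (chart b _).
by have [_ _ /(_ a)[_ inj] _ _] := Am; apply: inj; rewrite ?inE.
Qed.

Lemma transition_diff (a b : idx A) (p : N) : dom a p -> dom b p ->
  differentiable (transition a b) (chart a p).
Proof.
by move=> ap bp; have [_ _ _ _ /(_ a b [::])] := Am; apply; exists p.
Qed.

Lemma transition_near (a : idx A) (p : N) (P : set N) :
  dom a p -> open P -> P p ->
  \forall z \near chart a p, exists q, [/\ dom a q, P q & chart a q = z].
Proof.
move=> ap Po Pp; have [_ _ /(_ a)[ao _] homeo _] := Am.
have Wo : open (chart a @` (dom a `&` P)).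
  by apply/homeo; [exact: subIsetl|exact: openI].
have : nbhs (chart a p) (chart a @` (dom a `&` P)).
  by apply: open_nbhs_nbhs; split => //; exists p.
by apply: filterS => z [q [aq Pq] <-]; exists q.
Qed.

Lemma transition_chain (a b c : idx A) (p : N) (v : 'rV[R]_n) :
  dom a p -> dom b p -> dom c p ->
  'd (transition a c) (chart a p) v =
  'd (transition b c) (chart b p) ('d (transition a b) (chart a p) v).
Proof.
move=> ap bp cp; apply: diff_chain; [exact: transition_diff|exact: transition_diff|
  exact: transition_diff|exact: transitionE|].
have [_ _ domP _ _] := Am.
have := @transition_near a p (dom b `&` dom c) ap
  (openI (domP b).1 (domP c).1) (conj bp cp).
by apply: filterS => z [q [aq [bq cq] <-]]; rewrite !transitionE.
Qed.

Lemma transition_id (a : idx A) (p : N) (v : 'rV[R]_n) :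
  dom a p -> 'd (transition a a) (chart a p) v = v.
Proof.
move=> ap; apply: diff_near_id; first exact: transition_diff.
have [_ _ domP _ _] := Am.
have := @transition_near a p (dom a) ap (domP a).1 ap.
by apply: filterS => z [q [aq _ <-]]; rewrite transitionE.
Qed.

(* In a chart around p, every vector is the component vector of exactly one
   tangent vector at p. *)
Lemma tangent_exists (a : idx A) (p : N) (v : 'rV[R]_n) :
  dom a p -> exists X : tangent A p, X a = v.
Proof.
move=> ap; pose f b := if pselect (dom b p) then
  'd (transition a b) (chart a p) v else 0.
have fE b : dom b p -> f b = 'd (transition a b) (chart a p) v.
  by rewrite /f; case: pselect.
have fc b c : dom b p -> dom c p -> f c = 'd (transition b c) (chart b p) (f b).
  by move=> bp cp; rewrite !fE//; exact: transition_chain.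
have fo b : ~ dom b p -> f b = 0 by rewrite /f; case: pselect.
by exists (Tangent fc fo); rewrite /= fE// transition_id.
Qed.

Lemma tangent_inj (a : idx A) (p : N) (X Y : tangent A p) :
  dom a p -> X a = Y a -> X = Y.
Proof.
case: X Y => [X Xc Xo] [Y Yc Yo] /= ap XY.
have XYE : X = Y.
  apply/funext => b; case: (pselect (dom b p)) => bp; last by rewrite Xo// Yo.
  by rewrite (Xc a)// (Yc a)// XY.
by rewrite -XYE in Yc Yo *; congr Tangent; exact: Prop_irrelevance.
Qed.

End Tangent.

Lemma tangent_chart_imageE (R : realType) (n : nat) (N : topologicalType)
    (A : atlas R n N) (a : idx (tangent_atlas A)) (zv : 'rV[R]_(n + n)) :
  smooth_manifold A ->
  chart_image a zv <-> chart_image (a : idx A) (lsubmx zv).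
Proof.
move=> Am; split=> [[[p X] /= ap <-]|[p ap pz]]; first by rewrite row_mxKl; exists p.
have [X Xa] := tangent_exists Am (rsubmx zv) ap.
by exists (existT (tangent A) p X) => //=; rewrite pz Xa hsubmxK.
Qed.

(* K (a'(t)) is the covariant derivative of V along x, for every curve
   a = (x, V). *)
Lemma connection_mapE (R : realType) (n : nat)
    (Gam : 'rV[R]_n -> 'rV[R]_n -> 'rV[R]_n -> 'rV[R]_n)
    (x V : R -> 'rV[R]_n) (t : R) :
  derivable x t 1 -> derivable V t 1 ->
  let a := fun s => row_mx (x s) (V s) in
  dproj (derive1 a t) = derive1 x t /\
  connection_map Gam (a t) (derive1 a t) = covD Gam x V t.
Proof.
move=> dx dV a.
have da : derivable a t 1.
  apply/derivable_mxP => i j; rewrite (ord1 i) /a.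
  case: (split_ordP j) => k ->.
    under eq_fun do rewrite row_mxEl; have /derivable_mxP := dx; exact.
  under eq_fun do rewrite row_mxEr; have /derivable_mxP := dV; exact.
have aE : derive1 a t = row_mx (derive1 x t) (derive1 V t).
  rewrite !derive1E (derive_mx da) (derive_mx dx) (derive_mx dV).
  apply/rowP => j; rewrite !mxE; case: splitP => k jk; rewrite mxE;
    congr ('D_1 _ t); apply/funext => s; rewrite /a mxE; case: splitP => l jl.
  - by congr (x s _ _); apply/val_inj; rewrite /= -jk jl.
  - by have := ltn_ord k; rewrite -jk jl -ltn_subRL subnn.
  - by have := ltn_ord l; rewrite -jl jk -ltn_subRL subnn.
  - by congr (V s _ _); apply/val_inj/eqP; rewrite -(eqn_add2l n) -jk jl.
by rewrite aE /dproj /connection_map /covD !row_mxKl !row_mxKr addrC.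
Qed.

(* Main.v *)
(** In a chart, metric compatibility and symmetry of the Christoffel symbols
    [Gam] of [g] turn the neutral metric at [(z, v)] into the complete lift of
    [g],
      [G(X, Y) = g(X1, Y2) + g(X2, Y1) + (D_v g)(X1, Y1)],
    and, since second derivatives of [g] commute, the Christoffel symbols of
    [G] are the complete lift of [Gam],
      [(X, Y) |-> (Gam X1 Y1, (D_v Gam) X1 Y1 + Gam X2 Y1 + Gam X1 Y2)].
    The acceleration of [(x, V)] therefore has the first component
    [D_x' x'], and its second component is the Jacobi expression of [V] minus
    [Gam (D_x' x') V], a term that vanishes along a geodesic [x]. *)

Require Import Defs.
From HB Require Import structures.
From mathcomp Require Import all_boot all_order all_algebra.
From mathcomp Require Import all_classical all_reals all_analysis.
From mathcomp Require Import ring lra.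

Set Implicit Arguments.
Unset Strict Implicit.
Unset Printing Implicit Defensive.

Import Order.TTheory GRing.Theory Num.Theory.
Import numFieldNormedType.Exports.

Local Open Scope ring_scope.
Local Open Scope classical_set_scope.

(** * Derivatives *)

(** The first-order expansion of [f] at [x] is also one of [g], and its continuous linear part is
    then the differential of [g]. Identities in a chart hold only on its open image, so they are
    transported this way. *)
Lemma near_eq_differentiable (R : numFieldType) (V W : normedModType R)
    (f g : V -> W) (x : V) :
  (\forall y \near x, f y = g y) -> differentiable f x -> differentiable g x.
Proof.
move=> fg df.
have gE : g \o shift x = cst (g x) + 'd f x +o_ 0 id.
  have /diff_locally/eqaddoP fE := df.
  apply/eqaddoP => e e0; near=> y.
  have fgy : f (y + x) = g (y + x).
    near: y; have := fg; rewrite (near_shift 0 x) /= subr0.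
    by apply: filterS => y /=.
  have -> : (g \o shift x - (cst (g x) + 'd f x)) y =
      (f \o shift x - (cst (f x) + 'd f x)) y.
    by rewrite /= !fctE /= fgy (nbhs_singleton fg).
  by near: y; exact: fE.
have dE := diff_unique (diff_continuous df) gE.
by apply/diff_locallyP; rewrite dE; split => //; exact: diff_continuous.
Unshelve. all: by end_near. Qed.

Lemma differentiable_rV (R : realFieldType) (V : normedModType R) (m : nat)
    (f : V -> 'rV[R]_m) (x : V) :
  (forall j, differentiable (fun y => f y 0 j) x) -> differentiable f x.
Proof.
move=> df; have -> : f = \sum_j (fun y => f y 0 j *: delta_mx 0 j).
  by apply/funext => y; rewrite fct_sumE -row_sum_delta.
by apply: differentiable_sum => j; exact: differentiableZl.
Qed.

Lemma differentiable_big (R : numFieldType) (V : normedModType R) (I : Type)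
    (r : seq I) (F : I -> V -> R) (x : V) :
  (forall i, differentiable (F i) x) ->
  differentiable (fun y => \sum_(i <- r) F i y) x /\
  differentiable (fun y => \prod_(i <- r) F i y) x.
Proof.
move=> dF; elim: r => [|i r [IHs IHp]].
  by split; under eq_fun do rewrite big_nil; exact: differentiable_cst.
split; under eq_fun do rewrite big_cons.
  exact: differentiableD.
exact: differentiableM.
Qed.

Lemma differentiable_det (R : numFieldType) (V : normedModType R) (m : nat)
    (M : V -> 'M[R]_m) (x : V) :
  (forall i j, differentiable (fun y => M y i j) x) ->
  differentiable (fun y => \det (M y)) x.
Proof.
move=> dM; apply: (differentiable_big _ _).1 => s.
apply: differentiableM; first exact: differentiable_cst.
by apply: (differentiable_big _ _).2.
Qed.

(** Linearity is a hypothesis because forms and Christoffel symbols are known to be linear only at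
    points of a chart image; the structure is packed inside the proof. *)
Lemma linear_row_sum (R : nzRingType) (W : lmodType R) (m : nat)
    (f : 'rV[R]_m -> W) (v : 'rV[R]_m) : linear f ->
  f v = \sum_i v 0 i *: f (delta_mx 0 i).
Proof.
move=> flin; pose fM := GRing.isLinear.Build _ _ _ _ _ flin.
pose F : {linear 'rV[R]_m -> W} := HB.pack f fM.
rewrite -[f]/(F : _ -> _) {1}[v]row_sum_delta linear_sum; apply: eq_bigr => i _.
exact: linearZ.
Qed.

Lemma linear_at0 (R : pzRingType) (V W : lmodType R) (f : V -> W) :
  linear f -> f 0 = 0.
Proof. by move=> /(_ (-1) 0 0); rewrite !scaleN1r !addNr. Qed.

Section DeriveFamily.
Variables (R : realType) (T : normedModType R) (m : nat).
Variables (t w : T) (V : T -> 'rV[R]_m).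
Hypothesis dV : derivable V t w.

(** In the standard basis [L s (V s)] is a finite sum of products of scalar functions. This serves
    whenever a form or a Christoffel symbol at a moving point is applied to a moving vector. *)
Lemma is_derive_family (L : T -> 'rV[R]_m -> R) :
  (\forall s \near t, linear (L s)) -> (forall v, derivable (L ^~ v) t w) ->
  is_derive t w (fun s => L s (V s)) ('D_w (L ^~ (V t)) t + L t ('D_w V t)).
Proof.
move=> Llin dL; have Lt := nbhs_singleton Llin.
have dVi i : derivable (fun s => V s 0 i) t w by have /derivable_mxP := dV; exact.
have VE i : 'D_w (fun s => V s 0 i) t = ('D_w V t) 0 i by rewrite (derive_mx dV) mxE.
have famE (v : T -> 'rV[R]_m) : {near t, (\sum_i ((fun s => v s 0 i) *
    (fun s => L s (delta_mx 0 i)))) =1 (fun s => L s (v s))}.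
  apply: filterS Llin => s Ls; rewrite fct_sumE (linear_row_sum _ Ls).
  by apply: eq_bigr.
apply: (near_eq_is_derive (famE V)); apply: is_derive_eq.
  by apply: is_derive_sum => i; apply: is_deriveM; exact: derivableP.
(* The same expansion for the constant vector [V t] collects the terms in which only [L] is
   differentiated. *)
rewrite -(near_eq_derive _ (famE (cst (V t)))) derive_sum; last first.
  by move=> i; apply: derivableM; [exact: (derivable_cst (V t 0 i))|exact: dL].
rewrite (linear_row_sum _ Lt) -big_split /=; apply: eq_bigr => i _.
rewrite (deriveM (derivable_cst (V t 0 i) t w) (dL _)).
by rewrite (derive_cst (V t 0 i)) scaler0 addr0 VE [in RHS]/cst [X in _ + X]mulrC.
Qed.

Lemma is_derive_family_rV (k : nat) (L : T -> 'rV[R]_m -> 'rV[R]_k) :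
  (\forall s \near t, linear (L s)) -> (forall v, derivable (L ^~ v) t w) ->
  is_derive t w (fun s => L s (V s)) ('D_w (L ^~ (V t)) t + L t ('D_w V t)).
Proof.
move=> Llin dL.
have fam j : is_derive t w (fun s => L s (V s) 0 j)
    ('D_w (fun s => L s (V t) 0 j) t + L t ('D_w V t) 0 j).
  apply: (@is_derive_family (fun s v => L s v 0 j)).
    by apply: filterS Llin => s Ls a u v; rewrite Ls !mxE.
  by move=> v; have /derivable_mxP := dL v; exact.
have dLV : derivable (fun s => L s (V s)) t w.
  by apply/derivable_mxP => i j; rewrite (ord1 i); case: (fam j).
apply: DeriveDef => //; rewrite (derive_mx dLV); apply/rowP => j; rewrite !mxE.
by case: (fam j) => _ ->; rewrite (derive_mx (dL _)) mxE.
Qed.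

End DeriveFamily.

(** * Symmetry of second derivatives *)

Section SecondDerivatives.
Variables (R : realType) (V : normedModType R).
Implicit Types (f : V -> R) (z u v : V).

Lemma is_derive_line f (q u : V) (r : R) : derivable f (r *: u + q) u ->
  is_derive r 1 (fun s : R => f (s *: u + q)) ('D_u f (r *: u + q)).
Proof.
have E : (fun h : R => h^-1 *: (f ((h *: 1 + r) *: u + q) - f (r *: u + q))) =
    (fun h : R => h^-1 *: (f (h *: u + (r *: u + q)) - f (r *: u + q))).
  by apply/funext => h; rewrite [h *: 1]mulr1 scalerDl addrA.
by move=> df; apply: DeriveDef; [rewrite /derivable E|rewrite /derive E].
Qed.

(** The mean value theorem along [u] turns the second difference into [h] times an increment of
    ['D_u f]; differentiability of ['D_u f] at the single point [z] evaluates that increment up to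
    [o(h)]. *)
Lemma second_difference f z u v (eps : R) :
  (\forall y \near z, differentiable f y) -> differentiable ('D_u f) z ->
  0 < eps -> \forall h \near 0^'+,
  `|f (h *: u + (h *: v + z)) - f (h *: u + z) - f (h *: v + z) + f z
    - h ^+ 2 * 'D_v ('D_u f) z| <= eps * h ^+ 2.
Proof.
move=> fd ad eps0; rewrite (deriveE v ad); set a := 'D_u f in ad *.
set A := 'd a z; pose C := `|u| + `|v| + 1.
have C0 : 0 < C by rewrite ltr_wpDl// addr_ge0.
(* Two expansion errors will occur, each at most [e * (h * C)]; the summand 1 keeps [C] positive. *)
pose e := eps / (C *+ 2).
have e0 : 0 < e by rewrite divr_gt0// mulrn_wgt0.
have /diff_locally/eqaddoP/(_ e e0) aE := ad.
have fd0 : \forall y \near (0 : V), differentiable f (y + z).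
  by move: fd; rewrite (near_shift 0 z) subr0; apply: filterS.
have : nbhs (0 : V) ([set y | `|(a \o shift z - (cst (a z) + A)) y| <= e * `|y|] `&`
    [set y | differentiable f (y + z)]) by exact: filterI.
move=> /nbhs_ballP[d /= d0 dP].
have near_d y : `|y| < d -> `|a (y + z) - a z - A y| <= e * `|y| /\
    differentiable f (y + z).
  move=> yd; have [|+ dfy] := dP y; first by rewrite -ball_normE/= sub0r normrN.
  by rewrite !fctE /= opprD addrA => ?; split.
near=> h.
have h0 : 0 < h by near: h; exact: nbhs_right_gt.
have hd : h * C < d.
  by rewrite -ltr_pdivlMr//; near: h; apply: nbhs_right_lt; rewrite divr_gt0.
have small (r s : R) : 0 <= r <= h -> 0 <= s <= h -> `|r *: u + s *: v| <= h * C.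
  move=> /andP[r0 rh] /andP[s0 sh]; rewrite (le_trans (ler_normD _ _))// !normrZ.
  rewrite (ger0_norm r0) (ger0_norm s0) /C mulrDr mulrDr mulr1.
  by apply: ler_wpDr; [exact: ltW|apply: lerD; rewrite ler_wpM2r].
(* The second difference is [phi h - phi 0]. *)
pose phi (r : R) := f (r *: u + (h *: v + z)) - f (r *: u + z).
have hh : 0 <= h <= h by rewrite lexx ltW.
have h00 : (0 : R) <= 0 <= h by rewrite lexx ltW.
have phiD (r : R) : 0 <= r <= h -> is_derive r 1 phi
    (a (r *: u + (h *: v + z)) - a (r *: u + z)).
  move=> rh; apply: is_deriveB; apply: is_derive_line; apply: diff_derivable.
    by rewrite addrA; apply: (near_d _ _).2; exact: le_lt_trans (small _ _ rh hh) hd.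
  by have := small _ _ rh h00; rewrite scale0r addr0 => /le_lt_trans/(_ hd)/near_d[].
have phiC : {within `[0, h], continuous phi}.
  by apply: derivable_within_continuous => r; rewrite in_itv/= => /phiD[].
have [|c] := MVT (df := fun r => a (r *: u + (h *: v + z)) - a (r *: u + z)) h0 _ phiC.
  by move=> r; rewrite in_itv/= => /andP[r0 rh]; apply: phiD; rewrite !ltW.
rewrite in_itv/= => /andP[c0 ch] E.
have ch' : 0 <= c <= h by rewrite !ltW.
have -> : f (h *: u + (h *: v + z)) - f (h *: u + z) - f (h *: v + z) + f z =
    phi h - phi 0 by rewrite /phi scale0r !add0r; ring.
rewrite E subr0 addrA.
have s1 := small _ _ ch' hh; have [b1 _] := near_d _ (le_lt_trans s1 hd).
have s2 := small _ _ ch' h00; have [b2 _] := near_d _ (le_lt_trans s2 hd).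
move: s2 b2; rewrite scale0r addr0 => s2 b2.
have AE : A (c *: u + h *: v) = A (c *: u) + h * A v.
  by rewrite linearD; congr (_ + _); exact: linearZ.
(* Both values of ['D_u f] are compared with its affine approximation at [z]; the parts [a z] and
   [A (c *: u)] cancel. *)
have split_err (a1 a2 a0 A1 Av : R) : (a1 - a2) * h - h ^+ 2 * Av =
    h * ((a1 - a0 - (A1 + h * Av)) - (a2 - a0 - A1)) by ring.
rewrite (split_err _ _ (a z) (A (c *: u)) (A v)) -AE.
rewrite normrM (gtr0_norm h0).
have -> : eps * h ^+ 2 = h * (e * (h * C) + e * (h * C)).
  by rewrite /e; field; rewrite gt_eqF.
rewrite ler_pM2l// (le_trans (ler_normB _ _))// lerD//.
  by rewrite (le_trans b1)// ler_pM2l.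
by rewrite (le_trans b2)// ler_pM2l.
Unshelve. all: by end_near. Qed.

(* Young's form of the symmetry of second derivatives: both mixed derivatives
   are the limit of the same second difference quotient. *)
Lemma derive_comm f z u v :
  (\forall y \near z, differentiable f y) ->
  differentiable ('D_u f) z -> differentiable ('D_v f) z ->
  'D_u ('D_v f) z = 'D_v ('D_u f) z.
Proof.
move=> fd du dv; apply/eqP; rewrite -subr_eq0 -normr_le0; apply/ler_addgt0Pr => e e0.
have e2 : 0 < e / 2 by rewrite divr_gt0.
rewrite add0r.
(* One step [h] serves both estimates. The second difference is symmetric in [u] and [v], so
   subtraction leaves only the gap between the mixed derivatives. *)
have [h [h0 [b1 b2]]] := filter_ex (filterI (nbhs_right_gt (0 : R))
  (filterI (second_difference v fd du e2) (second_difference u fd dv e2))).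
rewrite -(ler_pM2l (exprn_gt0 2 h0)) -[X in X * `|_|]gtr0_norm ?exprn_gt0//.
rewrite -normrM; rewrite (addrCA (h *: v)) in b2.
move: b1 b2; set F := f (h *: u + _); set F1 := f _; set F2 := f _; set F0 := f z.
set D1 := 'D_v _ _; set D2 := 'D_u _ _ => b1 b2.
have -> : h ^+ 2 * (D2 - D1) = (F - F1 - F2 + F0 - h ^+ 2 * D1)
   - (F - F2 - F1 + F0 - h ^+ 2 * D2) by ring.
rewrite (le_trans (ler_normB _ _))// (le_trans (lerD b1 b2))//.
by rewrite -mulrDl -splitr mulrC.
Qed.

End SecondDerivatives.

Lemma derive_comp (R : realType) (T V W : normedModType R) (c : T -> V)
    (f : V -> W) (t w : T) :
  differentiable c t -> differentiable f (c t) ->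
  is_derive t w (f \o c) ('D_('D_w c t) f (c t)).
Proof.
move=> dc df; have dfc := differentiable_comp dc df.
apply: DeriveDef; first exact: diff_derivable.
by rewrite (deriveE w dfc) (deriveE _ df) (deriveE w dc) diff_comp.
Qed.

(** * Christoffel symbols of the neutral metric *)

(* Koszul's trick: a tensor symmetric in its first two arguments and
   antisymmetric in the last two vanishes. *)
Lemma koszul_unique (R : realType) (V : lmodType R) (b : V -> V -> R)
    (F F' : V -> V -> V) :
  is_bilinear *%R b -> (forall u v, b u v = b v u) ->
  (forall u, (forall v, b u v = 0) -> u = 0) ->
  (forall u v, F u v = F v u) -> (forall u v, F' u v = F' v u) ->
  (forall u v w, b (F u v) w + b v (F u w) = b (F' u v) w + b v (F' u w)) ->
  forall u v, F u v = F' u v.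
Proof.
move=> [bl _] bsym bnd Fs Fs' FF' u v; apply/subr0_eq/bnd => w.
have bB x y : b (x - y) w = b x w - b y w.
  by rewrite addrC -scaleN1r [LHS](bl w (-1) y x) mulN1r addrC.
rewrite bB.
(* Of these three cyclic instances, the first plus the second minus the third leaves twice the
   wanted equality. *)
have := FF' u v w; have := FF' v w u; have := FF' w u v.
rewrite (Fs w v) (Fs w u) (Fs v u) (Fs' w v) (Fs' w u) (Fs' v u).
rewrite !(bsym u) !(bsym v) !(bsym w).
by lra.
Qed.

(** The neutral metric in a single chart with the connection as a parameter: [neutral_metric g a]
    unfolds to [neutral_form (g a) (levi_civita g a)]. *)
Definition neutral_form (R : realType) (n : nat)
    (h : 'rV[R]_n -> 'rV[R]_n -> 'rV[R]_n -> R)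
    (Gam : 'rV[R]_n -> 'rV[R]_n -> 'rV[R]_n -> 'rV[R]_n)
    (zv X Y : 'rV[R]_(n + n)) : R :=
  h (lsubmx zv) (dproj X) (connection_map Gam zv Y)
  + h (lsubmx zv) (connection_map Gam zv X) (dproj Y).

(* [X1, X2] and [z, v] of the header are the left and right halves of the row
   vectors [X] and [zv]. *)
Definition complete_lift (R : realType) (n : nat)
    (Gam : 'rV[R]_n -> 'rV[R]_n -> 'rV[R]_n -> 'rV[R]_n)
    (zv X Y : 'rV[R]_(n + n)) : 'rV[R]_(n + n) :=
  row_mx (Gam (lsubmx zv) (lsubmx X) (lsubmx Y))
    ('D_(rsubmx zv) (fun y => Gam y (lsubmx X) (lsubmx Y)) (lsubmx zv)
     + Gam (lsubmx zv) (rsubmx X) (lsubmx Y)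
     + Gam (lsubmx zv) (lsubmx X) (rsubmx Y)).

Section LeviCivita.
Variables (R : realType) (n : nat) (U : set 'rV[R]_n).
Variables (h : 'rV[R]_n -> 'rV[R]_n -> 'rV[R]_n -> R).
Variables (Gam : 'rV[R]_n -> 'rV[R]_n -> 'rV[R]_n -> 'rV[R]_n).
Hypothesis Uo : open U.
Hypothesis hbil : forall z, U z -> is_bilinear *%R (h z).
Hypothesis hsym : forall z u v, U z -> h z u v = h z v u.
Hypothesis hnd : forall z u, U z -> (forall v, h z u v = 0) -> u = 0.
Hypothesis hsm : forall u v, smooth_on U (fun z => h z u v).
Hypothesis lc : is_levi_civita U h Gam.

Local Notation vec := 'rV[R]_n.
Local Notation e i := (delta_mx 0 i : vec).

Implicit Types (z u v w a b : vec).

Let near_dom z : U z -> \forall y \near z, U y.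
Proof. by move=> Uz; exact: open_nbhs_nbhs. Qed.

Lemma form_linl z w : U z -> linear ((h z)^~ w : vec -> R).
Proof. by move=> /hbil[/(_ w)]. Qed.

Lemma form_linr z w : U z -> linear (h z w : vec -> R).
Proof. by move=> /hbil[_ /(_ w)]. Qed.

Lemma formDl z u v w : U z -> h z (u + v) w = h z u w + h z v w.
Proof. by move=> Uz; have := form_linl w Uz 1 u v; rewrite /= !scale1r. Qed.

Lemma formDr z u v w : U z -> h z w (u + v) = h z w u + h z w v.
Proof. by move=> Uz; rewrite !(hsym w)// formDl. Qed.

Lemma form0l z w : U z -> h z 0 w = 0.
Proof. by move=> Uz; exact: linear_at0 (form_linl w Uz). Qed.

Lemma form0r z w : U z -> h z w 0 = 0.
Proof. by move=> Uz; rewrite hsym// form0l. Qed.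

Lemma formZl z (k : R) u w : U z -> h z (k *: u) w = k * h z u w.
Proof.
by move=> Uz; have := form_linl w Uz k u 0; rewrite /= form0l// !addr0.
Qed.

Lemma form_diff u v z : U z -> differentiable (fun y => h y u v) z.
Proof. exact: (hsm u v [::]). Qed.

Lemma form_derive_diff a u v z : U z ->
  differentiable ('D_a (fun y => h y u v)) z.
Proof. exact: (hsm u v [:: a]). Qed.

Lemma form_derive_comm a b u v z : U z ->
  'D_a ('D_b (fun y => h y u v)) z = 'D_b ('D_a (fun y => h y u v)) z.
Proof.
move=> Uz; apply: derive_comm; [|exact: form_derive_diff..].
by apply: filterS (near_dom Uz) => y; exact: form_diff.
Qed.

Lemma form_derive_lin u v z : U z ->
  linear (fun a => 'D_a (fun y => h y u v) z).
Proof.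
by move=> Uz k a b; rewrite !deriveE ?linearP//; exact: form_diff.
Qed.

Lemma christoffel_linl z v : U z -> linear ((Gam z)^~ v).
Proof. by move=> /lc[[/(_ v)]]. Qed.

Lemma christoffel_linr z v : U z -> linear (Gam z v).
Proof. by move=> /lc[[_ /(_ v)]]. Qed.

Lemma christoffel0l z v : U z -> Gam z 0 v = 0.
Proof. by move=> Uz; exact: linear_at0 (christoffel_linl v Uz). Qed.

Lemma christoffel0r z v : U z -> Gam z v 0 = 0.
Proof. by move=> Uz; exact: linear_at0 (christoffel_linr v Uz). Qed.

Lemma christoffel_sym z u v : U z -> Gam z u v = Gam z v u.
Proof.
move=> /lc[_ /(_ (cst u) (cst v)) + _]; rewrite /nabla /bracket !derive_cst subrr !add0r.
by move=> /(_ (differentiable_cst _ _) (differentiable_cst _ _)) /subr0_eq.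
Qed.

Lemma christoffel_metric z u v w : U z ->
  'D_u (fun y => h y v w) z = h z (Gam z u v) w + h z v (Gam z u w).
Proof.
move=> /lc[_ _ /(_ (cst u) (cst v) (cst w))]; rewrite /nabla !derive_cst !add0r.
by apply; exact: differentiable_cst.
Qed.

(** Since [Gam] is absent from the right-hand side, regularity passes from [h] to [Gam] through this
    formula. *)
Lemma christoffel_koszul z u v w : U z ->
  h z (Gam z u v) w = 2^-1 * ('D_u (fun y => h y v w) z
    + 'D_v (fun y => h y u w) z - 'D_w (fun y => h y u v) z).
Proof.
move=> Uz; rewrite !christoffel_metric//.
rewrite (christoffel_sym w u)// (christoffel_sym w v)// (christoffel_sym v u)//.
by rewrite (hsym (Gam z u w) v)//; field.
Qed.

Let gram z : 'M[R]_n := \matrix_(i, j) h z (e i) (e j).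

Let gramE z u j : U z -> h z u (e j) = (u *m gram z) 0 j.
Proof.
move=> Uz; rewrite (linear_row_sum u (form_linl (e j) Uz)) [RHS]mxE.
by apply: eq_bigr => k _; rewrite [in RHS]mxE.
Qed.

Let gram_unit z : U z -> gram z \in unitmx.
Proof.
move=> Uz; rewrite -row_free_unit -kermx_eq0; apply/eqP/row_matrixP => i.
rewrite row0; set u := row i _.
have ug : u *m gram z = 0 by apply/sub_kermxP; exact: row_sub.
apply: (hnd Uz) => w; rewrite (linear_row_sum w (form_linr u Uz)) big1// => j _.
by rewrite gramE// ug mxE scaler0.
Qed.

(** The Koszul formula makes the products of [Gam y u v] with the basis vectors differentiable, and
    the inverse Gram matrix recovers [Gam y u v] from them. *)
Lemma christoffel_diff z u v : U z -> differentiable (fun y => Gam y u v) z.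
Proof.
move=> Uz; pose k y := \row_j h y (Gam y u v) (e j).
have dk j : differentiable (fun y => k y 0 j) z.
  apply: (@near_eq_differentiable _ _ _ (fun y => 2^-1 *
    ('D_u (fun y => h y v (e j)) y + 'D_v (fun y => h y u (e j)) y
     - 'D_(e j) (fun y => h y u v) y))).
    by apply: filterS (near_dom Uz) => y Uy; rewrite mxE christoffel_koszul.
  apply: differentiableZ; apply: differentiableB; last exact: form_derive_diff.
  by apply: differentiableD; exact: form_derive_diff.
have dg i j : differentiable (fun y => gram y i j) z.
  by under eq_fun do rewrite mxE; exact: form_diff.
(* The inverse is written as adjugate over determinant, so that its entries are rational functions
   of the Gram entries. *)
apply: (@near_eq_differentiable _ _ _
  (fun y => k y *m ((\det (gram y))^-1 *: \adj (gram y)))).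
  apply: filterS (near_dom Uz) => y Uy; have gu := gram_unit Uy.
  have -> : k y = Gam y u v *m gram y by apply/rowP => j; rewrite mxE gramE.
  have -> : (\det (gram y))^-1 *: \adj (gram y) = invmx (gram y) by rewrite /invmx gu.
  by rewrite mulmxK.
apply: differentiable_rV => j; under eq_fun do rewrite mxE.
apply: (differentiable_big _ _).1 => i; apply: differentiableM => //.
under eq_fun do rewrite 2!mxE; apply: differentiableM.
  apply: differentiableV; first exact: differentiable_det.
  by rewrite -unitfE -unitmxE gram_unit.
rewrite /cofactor; apply: differentiableM; first exact: differentiable_cst.
by apply: differentiable_det => a b; under eq_fun do rewrite !mxE; exact: form_diff.
Qed.

(** * The neutral metric in a chart of the tangent bundle *)

Local Notation vec2 := 'rV[R]_(n + n).
Implicit Types (zv X Y W : vec2).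

Let U2 : set vec2 := [set zv | U (lsubmx zv)].
Let H := neutral_form h Gam.

Lemma tangent_dom_open : open U2.
Proof.
have : open (lsubmx @^-1` U : set vec2).
  by apply: open_comp => // zv _; exact: continuous_lsubmx.
by [].
Qed.

Let near_dom2 zv : U2 zv -> \forall y \near zv, U2 y.
Proof. by move=> Uzv; apply: open_nbhs_nbhs; split => //; exact: tangent_dom_open. Qed.

(** The Christoffel terms of the two connection maps combine, by symmetry and metric compatibility,
    into a derivative of [h] along the fibre coordinate. *)
Lemma neutral_formE zv X Y : U2 zv -> H zv X Y =
  h (lsubmx zv) (lsubmx X) (rsubmx Y) + h (lsubmx zv) (rsubmx X) (lsubmx Y)
  + 'D_(rsubmx zv) (fun y => h y (lsubmx X) (lsubmx Y)) (lsubmx zv).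
Proof.
move=> Uz; rewrite /H /neutral_form /connection_map /dproj.
rewrite christoffel_metric// formDl// formDr//.
rewrite (christoffel_sym (lsubmx X))// (christoffel_sym (lsubmx Y))//.
by ring.
Qed.

Lemma neutral_form_sym zv X Y : U2 zv -> H zv X Y = H zv Y X.
Proof.
by move=> Uz; rewrite /H /neutral_form addrC; congr (_ + _); exact: hsym.
Qed.

Lemma neutral_form_bil zv : U2 zv -> is_bilinear *%R (H zv).
Proof.
move=> Uz.
have Kl k X X' : connection_map Gam zv (k *: X + X') =
    k *: connection_map Gam zv X + connection_map Gam zv X'.
  by rewrite /connection_map !linearP christoffel_linl// scalerDr addrACA.
have Hl Y : linear_for *%R ((H zv)^~ Y).
  move=> k X X'; rewrite /H /neutral_form /dproj.
  move: (connection_map Gam zv) Kl => K Kl; rewrite Kl linearP.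
  by rewrite !formDl// !formZl//; ring.
by split => // X k Y Y'; rewrite !(@neutral_form_sym zv X)//; exact: Hl.
Qed.

(** Vertical vectors [row_mx 0 v] detect the left half of [X]; once it is zero, the vectors
    [row_mx v 0] detect the right half. *)
Lemma neutral_form_nondeg zv X : U2 zv -> (forall Y, H zv X Y = 0) -> X = 0.
Proof.
move=> Uz HX.
have X1 : lsubmx X = 0.
  apply: (hnd Uz) => v; have := HX (row_mx 0 v); rewrite neutral_formE//.
  rewrite row_mxKl row_mxKr christoffel_metric// christoffel0r// !form0r//.
  by rewrite !addr0.
have X2 : rsubmx X = 0.
  apply: (hnd Uz) => v; have := HX (row_mx v 0); rewrite neutral_formE//.
  rewrite row_mxKl row_mxKr X1 christoffel_metric// christoffel0r// !form0l//.
  by rewrite add0r !addr0.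
by rewrite -[X]hsubmxK X1 X2 row_mx0.
Qed.

Let is_derive_base (f : vec -> R) zv W : differentiable f (lsubmx zv) ->
  is_derive zv W (fun y : vec2 => f (lsubmx y)) ('D_(lsubmx W) f (lsubmx zv)).
Proof.
move=> df; have dl := differentiable_lsubmx (zv : 'M[R]_(1, n + n)).
have E : 'D_W (lsubmx : vec2 -> vec) zv = lsubmx W.
  by rewrite (deriveE _ dl) diff_lin//; exact: continuous_lsubmx.
by have := derive_comp W dl df; rewrite E.
Qed.

Lemma neutral_form_diff zv X Y : U2 zv -> differentiable (fun y => H y X Y) zv.
Proof.
move=> Uz; pose f u v y := h y u v.
(* The direction [rsubmx y] moves with [y]; expanding it in the basis leaves derivatives of [h] in
   fixed directions. *)
apply: (@near_eq_differentiable _ _ _ (fun y =>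
  f (lsubmx X) (rsubmx Y) (lsubmx y) + f (rsubmx X) (lsubmx Y) (lsubmx y)
  + \sum_i rsubmx y 0 i * 'D_(e i) (f (lsubmx X) (lsubmx Y)) (lsubmx y))).
  apply: filterS (near_dom2 Uz) => y Uy; rewrite neutral_formE//; congr (_ + _).
  by rewrite (linear_row_sum (rsubmx y) (form_derive_lin (lsubmx X) (lsubmx Y) Uy)).
have dl := differentiable_lsubmx (zv : 'M[R]_(1, n + n)).
have dr := differentiable_rsubmx (zv : 'M[R]_(1, n + n)).
apply: differentiableD.
  apply: differentiableD.
    exact: (differentiable_comp dl (form_diff (lsubmx X) (rsubmx Y) Uz)).
  exact: (differentiable_comp dl (form_diff (rsubmx X) (lsubmx Y) Uz)).
apply: (differentiable_big _ _).1 => i; apply: differentiableM.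
  exact: (differentiable_comp dr (differentiable_coord (rsubmx zv) 0 i)).
exact: (differentiable_comp dl (form_derive_diff (e i) (lsubmx X) (lsubmx Y) Uz)).
Qed.

(** The derivative term of [neutral_formE] depends on [zv] through both its base point and its
    direction; [is_derive_family] separates the two, which gives the last bracket. *)
Lemma neutral_form_derive zv X Y W : U2 zv -> 'D_W (fun y => H y X Y) zv =
  'D_(lsubmx W) (fun y => h y (lsubmx X) (rsubmx Y)) (lsubmx zv)
  + 'D_(lsubmx W) (fun y => h y (rsubmx X) (lsubmx Y)) (lsubmx zv)
  + ('D_(lsubmx W) ('D_(rsubmx zv) (fun y => h y (lsubmx X) (lsubmx Y))) (lsubmx zv)
     + 'D_(rsubmx W) (fun y => h y (lsubmx X) (lsubmx Y)) (lsubmx zv)).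
Proof.
move=> Uz; pose L (s : vec2) v := 'D_v (fun y => h y (lsubmx X) (lsubmx Y)) (lsubmx s).
have Ld v : is_derive zv W (L ^~ v)
    ('D_(lsubmx W) ('D_v (fun y => h y (lsubmx X) (lsubmx Y))) (lsubmx zv)).
  by apply: is_derive_base; exact: form_derive_diff.
have dr := differentiable_rsubmx (zv : 'M[R]_(1, n + n)).
have rE : 'D_W (rsubmx : vec2 -> vec) zv = rsubmx W.
  by rewrite (deriveE _ dr) diff_lin//; exact: continuous_rsubmx.
have Llin : \forall s \near zv, linear (L s).
  by apply: filterS (near_dom2 Uz) => s Us; exact: form_derive_lin.
have Lder v : derivable (L ^~ v) zv W by case: (Ld v).
have LD := is_derive_family (diff_derivable (v := W) dr) Llin Lder.
rewrite rE in LD; have [_ LE] := Ld (rsubmx zv); rewrite LE in LD.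
rewrite (near_eq_derive _ (g := (fun y => h (lsubmx y) (lsubmx X) (rsubmx Y))
  + (fun y => h (lsubmx y) (rsubmx X) (lsubmx Y)) + (fun y => L y (rsubmx y)))); last first.
  by apply: filterS (near_dom2 Uz) => y Uy; rewrite neutral_formE.
have A1 := is_derive_base W (form_diff (lsubmx X) (rsubmx Y) Uz).
have A2 := is_derive_base W (form_diff (rsubmx X) (lsubmx Y) Uz).
by have [_ ->] := is_deriveD (is_deriveD A1 A2) LD.
Qed.

(** * Symmetry and metric compatibility of the complete lift *)

Let CL := complete_lift Gam.

Lemma form_derive_sym a u v z : U z ->
  'D_a (fun y => h y u v) z = 'D_a (fun y => h y v u) z.
Proof.
move=> Uz; apply: near_eq_derive; apply: filterS (near_dom Uz) => y Uy.
exact: hsym.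
Qed.

Lemma christoffel_derive_sym a u v z : U z ->
  'D_a (fun y => Gam y u v) z = 'D_a (fun y => Gam y v u) z.
Proof.
move=> Uz; apply: near_eq_derive; apply: filterS (near_dom Uz) => y Uy.
exact: christoffel_sym.
Qed.

Lemma form_christoffel_derive z v a b c : U z ->
  is_derive z v (fun y => h y (Gam y a b) c)
    ('D_v (fun y => h y (Gam z a b) c) z
     + h z ('D_v (fun y => Gam y a b) z) c).
Proof.
move=> Uz.
apply: (@is_derive_family _ _ _ _ _ (fun y => Gam y a b) _ (fun y u => h y u c)).
- exact/diff_derivable/christoffel_diff.
- by apply: filterS (near_dom Uz) => y; exact: form_linl.
- by move=> u; exact/diff_derivable/form_diff.
Qed.

(** Once the derivatives are exchanged, compatibility replaces the inner ['D_a] by Christoffel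
    symbols. The outer ['D_v] then produces the derivatives of [Gam] along [v] that occur in the
    complete lift. *)
Lemma form_derive2 z v a u w : U z ->
  'D_a ('D_v (fun y => h y u w)) z =
  'D_v (fun y => h y (Gam z a u) w) z + h z ('D_v (fun y => Gam y a u) z) w
  + ('D_v (fun y => h y u (Gam z a w)) z + h z u ('D_v (fun y => Gam y a w) z)).
Proof.
move=> Uz; rewrite form_derive_comm//.
have D1 := form_christoffel_derive v a u w Uz.
have D2 := form_christoffel_derive v a w u Uz.
rewrite (near_eq_derive _ (g := (fun y => h y (Gam y a u) w)
  + (fun y => h y (Gam y a w) u))); last first.
  apply: filterS (near_dom Uz) => y Uy; rewrite christoffel_metric//.
  by congr (_ + _); exact: hsym.
have [_ ->] := is_deriveD D1 D2.
by rewrite (form_derive_sym v u)// (hsym u).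
Qed.

Lemma complete_lift_sym zv X Y : U2 zv -> CL zv X Y = CL zv Y X.
Proof.
move=> Uz; rewrite /CL /complete_lift christoffel_sym// christoffel_derive_sym//.
by rewrite (christoffel_sym (rsubmx X))// (christoffel_sym (lsubmx X))// addrAC.
Qed.

Lemma complete_lift_metric zv W X Y : U2 zv ->
  'D_W (fun y => H y X Y) zv = H zv (CL zv W X) Y + H zv X (CL zv W Y).
Proof.
move=> Uz; rewrite neutral_form_derive// !neutral_formE// !row_mxKl !row_mxKr.
rewrite form_derive2// !(christoffel_metric (lsubmx W))//.
rewrite (christoffel_metric (rsubmx W))// !formDl// !formDr//.
by ring.
Qed.

(** * Curvature and the Jacobi expression in coordinates *)

Lemma curvatureE z u v w : U z -> curvature Gam z u v w =
  'D_u (fun y => Gam y v w) z + Gam z u (Gam z v w)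
  - ('D_v (fun y => Gam y u w) z + Gam z v (Gam z u w)).
Proof.
move=> Uz.
have nE a b : nabla Gam (cst a) (cst b) = (fun y => Gam y a b).
  by apply/funext => y; rewrite /nabla derive_cst add0r.
rewrite /curvature /curvature_field !nE.
have -> : bracket (cst u) (cst v) = cst 0.
  by apply/funext => y; rewrite /bracket !derive_cst subrr.
by rewrite nE christoffel0l// subr0.
Qed.

Section Curve.
Variables (x V : R -> vec) (t : R).
Hypothesis Ux : \forall s \near t, U (x s).
Hypothesis dx : derivable x t 1.
Hypothesis dx' : derivable (derive1 x) t 1.
Hypothesis dV : derivable V t 1.
Hypothesis dV' : derivable (derive1 V) t 1.

Lemma covD2E : covD Gam x (covD Gam x V) t =
  derive1 (derive1 V) t
  + 'D_(derive1 x t) (fun y => Gam y (derive1 x t) (V t)) (x t)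
  + Gam (x t) (derive1 (derive1 x) t) (V t)
  + Gam (x t) (derive1 x t) (derive1 V t) *+ 2
  + Gam (x t) (derive1 x t) (Gam (x t) (derive1 x t) (V t)).
Proof.
have Uxt := nbhs_singleton Ux.
have xdiff : differentiable x t := (derivable1_diffP x t).1 dx.
(* [G1], [G2] and [G3] let the arguments of [Gam (x s) (derive1 x s) (V s)] move one after another:
   base point, direction, vector. *)
have G1 u v : is_derive t (1 : R) (fun s => Gam (x s) u v)
    ('D_(derive1 x t) (fun y => Gam y u v) (x t)).
  by rewrite derive1E; exact: (derive_comp (1 : R) xdiff (christoffel_diff u v Uxt)).
have D1 u v : derivable (fun s => Gam (x s) u v) t 1 by case: (G1 u v).
have Ll v : \forall s \near t, linear (fun u => Gam (x s) u v).
  by apply: filterS Ux => s Us; exact: christoffel_linl.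
have G2 v := is_derive_family_rV dx' (Ll v) (D1^~ v).
have D2 v : derivable (fun s => Gam (x s) (derive1 x s) v) t 1 by case: (G2 v).
have Lr : \forall s \near t, linear (fun v => Gam (x s) (derive1 x s) v).
  by apply: filterS Ux => s Us; exact: christoffel_linr.
have G3 := is_derive_family_rV dV Lr D2.
have [_ E] := is_deriveD (derivableP dV') G3.
have [_ E1] := G1 (derive1 x t) (V t).
have [_ E2] := G2 (V t).
rewrite {1}/covD derive1E; rewrite [X in X + _]E E2 E1 -!derive1E {1}/covD.
have -> a b c : Gam (x t) a (b + c) = Gam (x t) a b + Gam (x t) a c.
  by have := christoffel_linr a Uxt 1 b c; rewrite !scale1r.
by rewrite mulr2n !addrA.
Qed.

(** The derivative of [Gam] along [x'] and the iterated symbol [Gam x' (Gam x' V)] cancel against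
    the curvature. What pairs [V] with [x''] and with [Gam x' x'] adds up to the acceleration of
    [x]. *)
Lemma jacobi_expr :
  covD Gam x (covD Gam x V) t
    + curvature Gam (x t) (V t) (derive1 x t) (derive1 x t) =
  derive1 (derive1 V) t
  + 'D_(V t) (fun y => Gam y (derive1 x t) (derive1 x t)) (x t)
  + Gam (x t) (derive1 x t) (derive1 V t) *+ 2
  + Gam (x t) (covD Gam x (derive1 x) t) (V t).
Proof.
have Uxt := nbhs_singleton Ux.
rewrite covD2E curvatureE// (christoffel_derive_sym _ (V t))//.
rewrite (christoffel_sym (V t) (derive1 x t))//.
rewrite (christoffel_sym (V t) (Gam _ _ _))// {1}/covD.
have -> a b c : Gam (x t) (b + c) a = Gam (x t) b a + Gam (x t) c a.
  by have := christoffel_linl a Uxt 1 b c; rewrite !scale1r.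
move: (derive1 (derive1 V) t) ('D_(V t) _ _) ('D_(derive1 x t) _ _) => a b c.
move: (Gam (x t) _ (Gam _ _ _)) (Gam (x t) (Gam _ _ _) _) => d f.
move: (Gam (x t) _ (V t)) (Gam (x t) _ (derive1 V t)) => k l.
by apply/rowP => j; rewrite !mxE; ring.
Qed.

End Curve.

End LeviCivita.

(** Both sides are symmetric and compatible with the neutral form on constant fields, which is all
    that [koszul_unique] asks; no product rule for arbitrary fields has to be proved for the
    complete lift. *)
Lemma neutral_christoffel (R : realType) (n : nat) (U : set 'rV[R]_n)
    (h : 'rV[R]_n -> 'rV[R]_n -> 'rV[R]_n -> R)
    (Gam : 'rV[R]_n -> 'rV[R]_n -> 'rV[R]_n -> 'rV[R]_n)
    (GamG : 'rV[R]_(n + n) -> 'rV[R]_(n + n) -> 'rV[R]_(n + n) -> 'rV[R]_(n + n)) :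
  open U -> (forall z, U z -> is_bilinear *%R (h z)) ->
  (forall z u v, U z -> h z u v = h z v u) ->
  (forall z u, U z -> (forall v, h z u v = 0) -> u = 0) ->
  (forall u v, smooth_on U (fun z => h z u v)) ->
  is_levi_civita U h Gam ->
  is_levi_civita [set zv | U (lsubmx zv)] (neutral_form h Gam) GamG ->
  forall zv X Y, U (lsubmx zv) -> GamG zv X Y = complete_lift Gam zv X Y.
Proof.
move=> Uo hbil hsym hnd hsm lc lcG zv X Y Uzv.
have bil := neutral_form_bil hbil hsym lc (zv := zv) Uzv.
have sym Z W := neutral_form_sym Gam hsym (zv := zv) Z W Uzv.
have nd Z := neutral_form_nondeg hbil hsym hnd lc (zv := zv) (X := Z) Uzv.
apply: (koszul_unique bil sym nd).
- by move=> Z W; exact: (christoffel_sym lcG).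
- by move=> Z W; exact: (complete_lift_sym Uo lc).
- move=> Z W W'; rewrite -(christoffel_metric lcG)//.
  exact: (complete_lift_metric Uo hbil hsym hnd hsm lc).
Qed.

(** * Geodesics of the neutral metric *)

Lemma derive1_linear (R : realType) (V W : normedModType R)
    (f : {linear V -> W}) (c : R -> V) (t : R) :
  continuous f -> derivable c t 1 ->
  derivable (f \o c) t 1 /\ derive1 (f \o c) t = f (derive1 c t).
Proof.
move=> fc dc; have dct : differentiable c t := (derivable1_diffP c t).1 dc.
have df := linear_differentiable (c t) fc.
have [d E] := derive_comp (1 : R) dct df.
by split => //; rewrite !derive1E E (deriveE _ df) diff_lin.
Qed.

Lemma neutral_geodesicE (R : realType) (n : nat) (U : set 'rV[R]_n)
    (h : 'rV[R]_n -> 'rV[R]_n -> 'rV[R]_n -> R)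
    (Gam : 'rV[R]_n -> 'rV[R]_n -> 'rV[R]_n -> 'rV[R]_n)
    (GamG : 'rV[R]_(n + n) -> 'rV[R]_(n + n) -> 'rV[R]_(n + n) -> 'rV[R]_(n + n))
    (c : R -> 'rV[R]_(n + n)) (t : R) :
  open U -> (forall z, U z -> is_bilinear *%R (h z)) ->
  (forall z u v, U z -> h z u v = h z v u) ->
  (forall z u, U z -> (forall v, h z u v = 0) -> u = 0) ->
  (forall u v, smooth_on U (fun z => h z u v)) ->
  is_levi_civita U h Gam ->
  is_levi_civita [set zv | U (lsubmx zv)] (neutral_form h Gam) GamG ->
  (\forall s \near t, U (lsubmx (c s))) ->
  (\forall s \near t, derivable c s 1) -> derivable (derive1 c) t 1 ->
  let x := lsubmx \o c in let V := rsubmx \o c in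
  covD GamG c (derive1 c) t = 0 <->
  covD Gam x (derive1 x) t = 0 /\
  covD Gam x (covD Gam x V) t
    + curvature Gam (x t) (V t) (derive1 x t) (derive1 x t) = 0.
Proof.
move=> Uo hbil hsym hnd hsm lc lcG Ux dc dc' x V.
have Uxt := nbhs_singleton Ux; have dct := nbhs_singleton dc.
have cl := @continuous_lsubmx R 1 n n; have cr := @continuous_rsubmx R 1 n n.
have [dx xE] : derivable x t 1 /\ derive1 x t = lsubmx (derive1 c t).
  exact: derive1_linear cl dct.
have [dV VE] : derivable V t 1 /\ derive1 V t = rsubmx (derive1 c t).
  exact: derive1_linear cr dct.
(* Second derivatives at [t] require the first derivatives to be identified in a neighbourhood of
   [t]. *)
have xE' : {near t, lsubmx \o derive1 c =1 derive1 x}.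
  by apply: filterS dc => s /(derive1_linear cl)[_ ->].
have VE' : {near t, rsubmx \o derive1 c =1 derive1 V}.
  by apply: filterS dc => s /(derive1_linear cr)[_ ->].
have [dx1 xE1] := derive1_linear cl dc'; have [dV1 VE1] := derive1_linear cr dc'.
have dx' := near_eq_derivable xE' dx1; have dV' := near_eq_derivable VE' dV1.
rewrite derive1E (near_eq_derive _ xE') -derive1E in xE1.
rewrite derive1E (near_eq_derive _ VE') -derive1E in VE1.
(* The factor 2 arises from [Gam V' x'] and [Gam x' V'], equal by symmetry. *)
have accE : covD GamG c (derive1 c) t = row_mx (covD Gam x (derive1 x) t)
    (derive1 (derive1 V) t
     + 'D_(V t) (fun y => Gam y (derive1 x t) (derive1 x t)) (x t)
     + Gam (x t) (derive1 x t) (derive1 V t) *+ 2).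
  rewrite {1}/covD (neutral_christoffel Uo hbil hsym hnd hsm lc lcG)//.
  rewrite -[derive1 (derive1 c) t]hsubmxK /complete_lift add_row_mx -xE1 -VE1 -xE -VE.
  congr row_mx; rewrite (christoffel_sym lc (derive1 V t))//.
  by rewrite mulr2n !addrA.
rewrite (jacobi_expr Uo hbil hsym hnd hsm lc Ux dx dx' dV dV') accE.
have Gam0 : Gam (x t) 0 (V t) = 0 by exact: (christoffel0l lc).
split=> [|[geo]].
  by rewrite -[X in _ = X]row_mx0 => /eq_row_mx[geo jac]; rewrite geo jac Gam0 addr0.
by rewrite geo Gam0 addr0 => ->; exact: row_mx0.
Qed.

Theorem theorem2 (R : realType) (n : nat) (N : topologicalType)
  (A : atlas R n N) (g : form_field A) (J : set R)
  (x : R -> N) (V : forall t : R, tangent A (x t)) :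
  smooth_manifold A ->
  riemannian_metric g ->
  open J -> is_interval J ->
  smooth_curve (tangent_atlas A) J (fun t => existT (tangent A) (x t) (V t)) ->
  geodesic (neutral_metric g) J (fun t => existT (tangent A) (x t) (V t))
  <-> (geodesic g J x /\ jacobi_field g J V).
Proof.
move=> Am gR Jo _ smooth.
(* The tangent atlas has the indices of [A], and its domains see only the base point, so all three
   conditions range over the same charts and times. *)
suff chartwise (a : idx A) t : J t -> dom a (x t) ->
    let xa := fun s => chart a (x s) in
    let Va := fun s => V s a in
    let c := fun s => row_mx (xa s) (Va s) in
    covD (levi_civita (neutral_metric g) a) c (derive1 c) t = 0 <->
    covD (levi_civita g a) xa (derive1 xa) t = 0 /\
    covD (levi_civita g a) xa (covD (levi_civita g a) xa Va) t
      + curvature (levi_civita g a) (xa t) (Va t) (derive1 xa t) (derive1 xa t) = 0.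
  split=> [geo|[geo jac] a t Jt at_]; last by apply/(chartwise a t Jt at_); split;
    [exact: geo|exact: jac].
  by split=> a t Jt at_; have [] := (chartwise a t Jt at_).1 (geo a t Jt at_).
move=> Jt at_ xa Va c.
have [_ _ domP homeo _] := Am; have [gbil gsym gpos gsmooth _] := gR.
have Uo : open (chart_image (a : idx A)) by apply/homeo => //; case: (domP a).
have hbil := gbil a; have hsym z u v := gsym a z u v; have hsm u v := gsmooth a u v.
have hnd z u : chart_image a z -> (forall v, g a z u v = 0) -> u = 0.
  move=> Uz gu0; apply/eqP; apply: contraT => u0.
  by have := gpos a z u Uz u0; rewrite gu0 ltxx.
have lc : is_levi_civita (chart_image a) (g a) (levi_civita g a) :=
  levi_civitaP Am gR.
have UE : chart_image (a : idx (tangent_atlas A)) =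
    [set zv | chart_image (a : idx A) (lsubmx zv)].
  by apply/seteqP; split=> zv /(tangent_chart_imageE a zv Am).
have lcG : is_levi_civita [set zv | chart_image (a : idx A) (lsubmx zv)]
    (neutral_form (g a) (levi_civita g a)) (levi_civita (neutral_metric g) a).
  (* [levi_civita] is a choice with a default value; existence ensures that the chosen value is a
     Levi-Civita connection. *)
  have : exists GamG, is_levi_civita [set zv | chart_image (a : idx A) (lsubmx zv)]
      (neutral_form (g a) (levi_civita g a)) GamG.
    apply: levi_civita_exists.
    - by move=> zv Uz; exact: (neutral_form_bil hbil hsym lc).
    - by move=> zv X Y Uz; exact: (neutral_form_sym _ hsym).
    - by move=> zv X Uz; exact: (neutral_form_nondeg hbil hsym hnd lc).
    - exact: tangent_dom_open.
    - by move=> zv X Y Uz; exact: (neutral_form_diff Uo hbil hsym hsm lc).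
  rewrite -UE => exG; exact: (xgetPex (fun _ _ _ => 0) exG).
have [cnear cder] := smooth a t Jt at_.
have Jnear : \forall s \near t, J s by exact: open_nbhs_nbhs.
have xE : lsubmx \o c = xa by apply/funext => s; exact: row_mxKl.
have VE : rsubmx \o c = Va by apply/funext => s; exact: row_mxKr.
have := neutral_geodesicE (c := c) (t := t) Uo hbil hsym hnd hsm lc lcG.
rewrite xE VE; apply.
- by apply: filterS cnear => s as_; rewrite row_mxKl; exists (x s).
(* Order 0 of [smooth_curve], used at all parameters near [t], gives the first derivative there;
   order 1 at [t] gives the second. *)
- by apply: filterS2 Jnear cnear => s Js as_; have [_ /(_ 0%N)] := smooth a s Js as_.
- exact: (cder 1%N).
Qed.
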